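(* Let $n\in\mathbb{N}$ and $\alpha\geq 0$ with $n>\alpha+1$. Then for every $a\in\mathbb{R}\setminus\{0\}$, $b>0$ and every $f\in C_\alpha^n([b,\infty))$ the limit $$\mathcal{I}_{a,b}(f):=\lim_{\varepsilon\to 0^+}I_{a,b}^{\varepsilon,y_0}(f)=\lim_{\varepsilon\to 0^+}\int_b^\infty e^{-\varepsilon(y-y_0)^2}e^{iay^2}f(y)\,dy$$ exists for every $y_0\in\mathbb{R}$ and is independent of $y_0\in\mathbb{R}$. Moreover, there are constants $D_{a,b,n,\alpha}\geq 0$ (depending only on $a,b,n,\alpha$) such that for every $a\in\mathbb{R}\setminus\{0\}$, $b>0$, $f\in C_\alpha^n([b,\infty))$, $y_0\in\mathbb{R}$ and $0<\varepsilon\leq 1$ one has $$|I_{a,b}^{\varepsilon,y_0}(f)|\leq D_{a,b,n,\alpha}\Vert f\Vert_{C_\alpha^n([b,\infty))}\quad\text{and}\quad|\mathcal{I}_{a,b}(f)|\leq D_{a,b,n,\alpha}\Vert f\Vert_{C_\alpha^n([b,\infty))},$$ where $D_{a,b,n,\alpha}$ depends continuously on $(a,b)\in(\mathbb{R}\setminus\{0\})\times(0,\infty)$ and, for fixed $b,n,\alpha$, satisfies $D_{a,b,n,\alpha}=\mathcal{O}\big(\frac{1}{|a|}\big)$ as $|a|\to\infty$.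
   Context: All functions are complex-valued. For $b>0$, $n\in\mathbb{N}_0$, $\alpha\geq 0$, let $C^n_\alpha([b,\infty)):=\{f\in C^n([b,\infty)) : \text{there is } M\geq 0 \text{ with } |f^{(n)}(y)|\leq My^\alpha \text{ for all } y\in[b,\infty)\}$, with norm $$\Vert f\Vert_{C_\alpha^n([b,\infty))}:=\sum_{k=0}^{n-1}\frac{|f^{(k)}(b)|}{b^{n-k+\alpha}}+\sup_{y\in[b,\infty)}\frac{|f^{(n)}(y)|}{y^\alpha}$$ (an empty sum is $0$). For $a\in\mathbb{R}\setminus\{0\}$, $b>0$, $\varepsilon>0$, $y_0\in\mathbb{R}$, the regularized integral is the Lebesgue integral $I_{a,b}^{\varepsilon,y_0}(f):=\int_b^\infty e^{-\varepsilon(y-y_0)^2}e^{iay^2}f(y)\,dy$. *)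

(* Defs.v *)
From HB Require Import structures.
From mathcomp Require Import all_boot all_order all_algebra.
From mathcomp Require Import complex.
From mathcomp Require Import all_classical all_reals all_analysis.

Set Implicit Arguments.
Unset Strict Implicit.
Unset Printing Implicit Defensive.

Import Order.TTheory GRing.Theory Num.Theory.
Import numFieldNormedType.Exports.

Local Open Scope classical_set_scope.
Local Open Scope ring_scope.

(* Complex-valued functions take values in R[i]^o, the regular algebra over
   R[i]: the alias carries the normed topology of R[i]. A function on [b, oo) is
   represented by a total function, of which only the values on [b, oo) matter
   in everything below. *)

(* R[i] is normed over itself and not over R, so the library's derivative does
   not apply to functions R -> R[i]. At y = b this is a one-sided limit. *)
Definition diff_quot (R : realType) (f : R -> R[i]^o) (y z : R) : R[i]^o :=
  (f z - f y) / (z - y)%:C%C.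

Definition derivable_on (R : realType) (b : R) (f : R -> R[i]^o) : Prop :=
  forall y : R, b <= y ->
    cvg (diff_quot f y z @[z --> within `[b, +oo[ y^']).

Definition deriv_on (R : realType) (b : R) (f : R -> R[i]^o) : R -> R[i]^o :=
  fun y => lim (diff_quot f y z @[z --> within `[b, +oo[ y^']).

Definition derivn_on (R : realType) (b : R) (n : nat) (f : R -> R[i]^o) :
    R -> R[i]^o :=
  iter n (deriv_on b) f.

Definition Cn (R : realType) (b : R) (n : nat) (f : R -> R[i]^o) : Prop :=
  (forall k, (k < n)%N -> derivable_on b (derivn_on b k f)) /\
  {within `[b, +oo[, continuous (derivn_on b n f)}.

Definition Cn_alpha (R : realType) (b : R) (n : nat) (alpha : R)
    (f : R -> R[i]^o) : Prop :=
  Cn b n f /\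
  exists2 M : R, 0 <= M &
    forall y, b <= y -> Normc.normc (derivn_on b n f y) <= M * y `^ alpha.

Definition Cn_alpha_norm (R : realType) (b : R) (n : nat) (alpha : R)
    (f : R -> R[i]^o) : R :=
  \sum_(k < n) Normc.normc (derivn_on b k f b) / b `^ ((n - k)%:R + alpha) +
  sup [set Normc.normc (derivn_on b n f y) / y `^ alpha | y in `[b, +oo[].

Definition cintegrable (R : realType) (D : set R) (g : R -> R[i]^o) : Prop :=
  (@lebesgue_measure R).-integrable D (fun y => (complex.Re (g y))%:E) /\
  (@lebesgue_measure R).-integrable D (fun y => (complex.Im (g y))%:E).

Definition cintegral (R : realType) (D : set R) (g : R -> R[i]^o) : R[i]^o :=
  ((\int[@lebesgue_measure R]_(y in D) complex.Re (g y))
   +i* (\int[@lebesgue_measure R]_(y in D) complex.Im (g y)))%C.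

Definition expi (R : realType) (t : R) : R[i]^o := (cos t +i* sin t)%C.

Definition reg_integrand (R : realType) (a y0 : R) (f : R -> R[i]^o) (eps : R) :
    R -> R[i]^o :=
  fun y => (expR (- eps * (y - y0) ^+ 2))%:C%C * expi (a * y ^+ 2) * f y.

Definition reg_int (R : realType) (a b y0 : R) (f : R -> R[i]^o) (eps : R) :
    R[i]^o :=
  cintegral `[b, +oo[ (reg_integrand a y0 f eps).

Definition osc_int (R : realType) (a b y0 : R) (f : R -> R[i]^o) : R[i]^o :=
  lim (reg_int a b y0 f eps @[eps --> 0^'+]).

(* Main.v *)
Require Import Defs.
From HB Require Import structures.
From mathcomp Require Import all_boot all_order all_algebra.
From mathcomp Require Import complex.
From mathcomp Require Import all_classical all_reals all_analysis.
From mathcomp Require Import measurable_realfun zify ring lra.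

(** The integrand has the phase
      psi(y) = - eps (y - y0)^2 + i a y^2,
    whose derivative psi' is affine with imaginary part 2 a y. Hence
    |1 / psi'(y)| <= 1 / (2 |a| y) for all eps and y0, and psi'' is a constant
    of modulus at most 2 (|a| + 1) when eps <= 1. This is why no bound depends
    on eps or y0: the Gaussian is kept inside the exponential that is
    integrated by parts, instead of being differentiated together with f, which
    would produce factors that grow with y0.

    With J(m, j) the integral over [b, oo) of e^psi (1 / psi')^m f^(j),
    integrating e^psi = (e^psi)' / psi' by parts gives, for j < n,
      J(m, j) = - (e^psi (1 / psi')^(m+1) f^(j))(b) - J(m+1, j+1)
                + (m+1) psi'' J(m+2, j)                 (osc_term_step),
    the boundary term at infinity being killed by the Gaussian. Both new
    integrals have m + j larger by 2, so after n steps the integral J(0, 0) of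
    the statement is a combination of boundary values and of integrals J(m, j)
    with m + j = 2n and j <= n. Taylor's formula gives
    |f^(j)(y)| <= 3^(n-j) ||f|| y^(n-j+alpha) (derivn_on_growth), so the
    integrand of such a J(m, j) is at most a constant times y^(alpha - n),
    which is integrable because n > alpha + 1.

    The theorem follows by going back along the recursion. Bounding every term
    gives a bound osc_const * ||f|| (osc_term_le); dominated convergence at the
    terminal integrals gives a limit as eps tends to 0, in which y0 no longer
    appears because psi(y) = i a y^2 at eps = 0 (osc_term_cvg). The recursive
    formula for osc_const is continuous in (a, b), and a single integration by
    parts already contributes a factor 1 / |a| (osc_const_decay). *)

Set Implicit Arguments.
Unset Strict Implicit.
Unset Printing Implicit Defensive.

Import Order.TTheory GRing.Theory Num.Theory.
Import numFieldNormedType.Exports.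

Local Open Scope classical_set_scope.
Local Open Scope ring_scope.

(** * Convergence of complex-valued functions *)

Section ComplexNorm.
Variable R : realType.
Implicit Types z w : R[i].
Local Notation normc := Normc.normc.

Lemma normcE z : `|z| = (normc z)%:C%C.
Proof. by case: z. Qed.

Lemma normc_ge0 z : 0 <= normc z.
Proof. by case: z => x y; exact: sqrtr_ge0. Qed.

Lemma ler_normcD z w : normc (z + w) <= normc z + normc w.
Proof. by rewrite -lecR rmorphD /= -!normcE ler_normD. Qed.

Lemma normcN z : normc (- z) = normc z.
Proof. by case: z => x y; rewrite /= !sqrrN. Qed.

Lemma normcX z m : normc (z ^+ m) = normc z ^+ m.
Proof.
elim: m => [|m IH]; first by rewrite !expr0 Normc.normc1.
by rewrite !exprS Normc.normcM IH.
Qed.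

Lemma normcR (x : R) : normc x%:C%C = `|x|.
Proof. by rewrite /= expr0n addr0 sqrtr_sqr. Qed.

Lemma ler_Re_normc z : `|complex.Re z| <= normc z.
Proof. by case: z => x y /=; rewrite -sqrtr_sqr ler_wsqrtr// lerDl sqr_ge0. Qed.

Lemma ler_Im_normc z : `|complex.Im z| <= normc z.
Proof. by case: z => x y /=; rewrite -sqrtr_sqr ler_wsqrtr// lerDr sqr_ge0. Qed.

Lemma ler_normc_ReIm z : normc z <= `|complex.Re z| + `|complex.Im z|.
Proof.
case: z => x y /=.
rewrite -[leRHS]ger0_norm ?addr_ge0// -[leRHS]sqrtr_sqr ler_wsqrtr//.
rewrite sqrrD !real_normK ?num_real// addrAC lerDl mulrn_wge0//.
Qed.

Lemma normc_expi (t : R) : normc (expi t : R[i]) = 1.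
Proof. by rewrite /= cos2Dsin2 sqrtr1. Qed.

(** The norm of R[i] takes values in R[i], with positive radii that are
    real complex numbers; this brings convergence back to the real line. *)
Lemma cvgC_normc (T : Type) (F : set_system T) (FF : Filter F)
    (f : T -> R[i]^o) (l : R[i]^o) :
  f t @[t --> F] --> l <-> normc (f t - l) @[t --> F] --> (0 : R).
Proof.
split.
- move=> /cvgrPdist_lt fl; apply/cvgrPdist_lt => e e0.
  have e0' : 0 < e%:C%C by rewrite ltcR.
  have := fl _ e0'; apply: filterS => t.
  by rewrite sub0r normrN (ger0_norm (normc_ge0 _)) distrC normcE ltcR.
- move=> /cvgrPdist_lt fl; apply/cvgrPdist_lt => -[e e']; rewrite ltcE /=.
  move=> /andP[/eqP -> e0].
  have := fl _ e0; apply: filterS => t.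
  by rewrite sub0r normrN (ger0_norm (normc_ge0 _)) distrC normcE ltcR.
Qed.

Lemma cvgC_ReIm (T : Type) (F : set_system T) (FF : Filter F)
    (f : T -> R[i]^o) (l : R[i]^o) :
  f t @[t --> F] --> l <->
  complex.Re (f t) @[t --> F] --> complex.Re l /\
  complex.Im (f t) @[t --> F] --> complex.Im l.
Proof.
rewrite cvgC_normc; split.
- move=> /cvgrPdist_lt fl; split; apply/cvgrPdist_lt => e e0;
    have := fl _ e0; apply: filterS => t;
    rewrite sub0r normrN (ger0_norm (normc_ge0 _)) distrC; apply: le_lt_trans.
  + by have := ler_Re_normc (f t - l); rewrite raddfB.
  + by have := ler_Im_normc (f t - l); rewrite raddfB.
- move=> [fR fI].
  have aux (g : T -> R) (k : R) :
      g t @[t --> F] --> k -> `|g t - k| @[t --> F] --> (0 : R).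
    move=> gk; have <- : `|k - k| = 0 by rewrite subrr normr0.
    by apply: cvg_norm; apply: cvgB => //; exact: cvg_cst.
  apply: (@squeeze_cvgr _ _ _ _ (cst 0)
    (fun t => `|complex.Re (f t) - complex.Re l| +
              `|complex.Im (f t) - complex.Im l|)).
  + apply: nearW => t; rewrite normc_ge0 /=.
    by have := ler_normc_ReIm (f t - l); rewrite !raddfB.
  + exact: cvg_cst.
  + by rewrite -[X in _ --> X]addr0; apply: cvgD; exact: aux.
Qed.

Lemma cvgC_X (T : Type) (F : set_system T) (FF : Filter F)
    (f : T -> R[i]^o) (l : R[i]^o) m :
  f t @[t --> F] --> l -> f t ^+ m @[t --> F] --> l ^+ m.
Proof.
move=> fl; elim: m => [|m IH].
  rewrite (_ : (fun t => f t ^+ 0) = fun=> 1); last first.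
    by apply/funext => t; rewrite expr0.
  by rewrite expr0; exact: cvg_cst.
rewrite (_ : (fun t => f t ^+ m.+1) = fun t => f t * f t ^+ m); last first.
  by apply/funext => t; rewrite exprS.
by rewrite exprS; apply: cvgM; [exact: fl|exact: IH].
Qed.

End ComplexNorm.

(** * One-sided derivatives on a half-line *)

Section HalfLine.
Variable R : realType.
Local Notation normc := Normc.normc.
Implicit Types (b y : R) (F G H : R -> R[i]^o).

(** Relational form of deriv_on: a derivative that has been computed can be
    used without going through the limit operator. *)
Definition has_deriv_on b F G := forall y, b <= y ->
  diff_quot F y z @[z --> within `[b, +oo[ y^'] --> G y.

(** Continuity on [b, +oo[ as a family of limits along filters, the form in
    which the algebra of limits applies; see cont_onE. *)
Definition cont_on b F := forall y, b <= y ->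
  F z @[z --> within `[b, +oo[ (nbhs y)] --> F y.

Lemma near_itv_gt b y : b < y ->
  \forall z \near y, (`[b, +oo[%classic : set R) z.
Proof.
move=> by_; near=> z; rewrite /= in_itv/= andbT ltW//.
by near: z; exact: lt_nbhsr.
Unshelve. all: by end_near. Qed.

(** In the interior of the half-line the one-sided quotients of diff_quot
    are the ordinary two-sided ones. *)
Lemma within_dnbhs_gt b y : b < y -> within `[b, +oo[ y^' = y^'.
Proof.
move=> /near_itv_gt HA; apply/seteqP.
split => P; rewrite /dnbhs /within /= => H.
- by apply: filterS2 HA H => z /= Az + zy; apply.
- by apply: filterS H => z /= + zy _; apply.
Qed.

Lemma cont_onE b F : cont_on b F <-> {within `[b, +oo[, continuous F}.
Proof.
rewrite subspace_continuousP /cont_on.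
by split => cF y /= => [|by_]; [rewrite in_itv/= andbT|
  have := cF y; rewrite /= in_itv/= andbT => /(_ by_)] => //; exact: cF.
Qed.

Lemma cont_on_Re b F : cont_on b F ->
  {within `[b, +oo[, continuous (fun y => complex.Re (F y))}.
Proof.
move=> cF; apply/subspace_continuousP => y /=; rewrite in_itv/= andbT => by_.
by have /cvgC_ReIm[] := cF y by_.
Qed.

Lemma cont_on_Im b F : cont_on b F ->
  {within `[b, +oo[, continuous (fun y => complex.Im (F y))}.
Proof.
move=> cF; apply/subspace_continuousP => y /=; rewrite in_itv/= andbT => by_.
by have /cvgC_ReIm[] := cF y by_.
Qed.

Lemma cont_onD b F G : cont_on b F -> cont_on b G ->
  cont_on b (fun y => F y + G y).
Proof. by move=> cF cG y by_; apply: cvgD; [exact: cF|exact: cG]. Qed.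

Lemma cont_onM b F G : cont_on b F -> cont_on b G ->
  cont_on b (fun y => F y * G y).
Proof. by move=> cF cG y by_; apply: cvgM; [exact: cF|exact: cG]. Qed.

Lemma cont_on_cst b (c : R[i]^o) : cont_on b (fun=> c).
Proof. by move=> y by_; exact: cvg_cst. Qed.

Lemma cont_onX b F m : cont_on b F -> cont_on b (fun y => F y ^+ m).
Proof.
by move=> cF y by_; apply: cvgC_X; exact: cF.
Qed.

Lemma cvg_sub_real_complex b y :
  ((z - y)%:C%C : R[i]^o) @[z --> within `[b, +oo[ y^'] --> (0 : R[i]^o).
Proof.
apply/cvgC_ReIm; split => /=; last exact: cvg_cst.
rewrite -[X in _ --> X](subrr y); apply: cvgB; last exact: cvg_cst.
apply: cvg_within_filter; apply: cvg_within.
Qed.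

Lemma near_within_dnbhs b y :
  \forall z \near within `[b, +oo[ y^', z != y /\ b <= z.
Proof.
have : \forall z \near nbhs y, z != y -> `[b, +oo[%classic z ->
    z != y /\ b <= z.
  by apply: nearW => z zy; rewrite /= in_itv/= andbT.
exact.
Qed.

Lemma has_deriv_on_cvg b F G y : has_deriv_on b F G -> b <= y ->
  F z @[z --> within `[b, +oo[ y^'] --> F y.
Proof.
move=> dF by_.
have : diff_quot F y z * (z - y)%:C%C + F y @[z --> within `[b, +oo[ y^']
    --> F y.
  rewrite -[X in _ --> X]add0r -(mulr0 (G y)); apply: cvgD; last exact: cvg_cst.
  by apply: cvgM; [exact: dF|exact: cvg_sub_real_complex].
apply: cvg_trans; apply: near_eq_cvg.
apply: filterS (near_within_dnbhs b y) => z [zy _].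
by rewrite /diff_quot divfK ?subrK// eq_complex/= subr_eq0 (negbTE zy).
Qed.

Lemma has_deriv_on_cont b F G : has_deriv_on b F G -> cont_on b F.
Proof.
move=> dF y by_ U FU.
have H : \forall z \near nbhs y, z != y -> `[b, +oo[%classic z -> U (F z).
  exact: has_deriv_on_cvg dF by_ _ FU.
suff : \forall z \near nbhs y, `[b, +oo[%classic z -> U (F z) by [].
apply: filterS H => z HU bz.
have [->|zy] := eqVneq z y; first exact: nbhs_singleton.
exact: HU.
Qed.

Lemma has_deriv_onM b F G F' G' : has_deriv_on b F F' -> has_deriv_on b G G' ->
  has_deriv_on b (fun y => F y * G y) (fun y => F' y * G y + F y * G' y).
Proof.
move=> dF dG y by_.
have : diff_quot F y z * G y + F z * diff_quot G y z
    @[z --> within `[b, +oo[ y^'] --> F' y * G y + F y * G' y.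
  apply: cvgD.
    by apply: cvgM; [exact: dF|exact: cvg_cst].
  by apply: cvgM; [exact: has_deriv_on_cvg dF by_|exact: dG].
apply: cvg_trans; apply: near_eq_cvg; apply: nearW => z.
by rewrite /diff_quot mulrAC mulrA -mulrDl; congr (_ / _); ring.
Qed.

Lemma has_deriv_on_ext b F G G' : (forall y, b <= y -> G y = G' y) ->
  has_deriv_on b F G -> has_deriv_on b F G'.
Proof. by move=> GG' dF y by_; rewrite -GG'//; exact: dF. Qed.

Lemma has_deriv_onV b F F' : (forall y, b <= y -> F y != 0) ->
  has_deriv_on b F F' ->
  has_deriv_on b (fun y => (F y)^-1) (fun y => - F' y * (F y)^-1 ^+ 2).
Proof.
move=> F0 dF y by_.
have : - diff_quot F y z * ((F z)^-1 * (F y)^-1) @[z --> within `[b, +oo[ y^']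
    --> - F' y * (F y)^-1 ^+ 2.
  apply: cvgM; first by apply: cvgN; exact: dF.
  apply: cvgM; last exact: cvg_cst.
  by apply: cvgV; [exact: F0|exact: has_deriv_on_cvg dF by_].
apply: cvg_trans; apply: near_eq_cvg.
apply: filterS (near_within_dnbhs b y) => z [zy bz].
rewrite /diff_quot -mulNr mulrAC; congr (_ / _).
have Fy := F0 _ by_; have Fz := F0 _ bz.
by field; rewrite Fy Fz.
Qed.

Lemma has_deriv_onXS b F F' m : has_deriv_on b F F' ->
  has_deriv_on b (fun y => F y ^+ m.+1) (fun y => m.+1%:R * F y ^+ m * F' y).
Proof.
move=> dF; elim: m => [|m IH].
  rewrite (_ : (fun y => F y ^+ 1) = F); last by apply/funext => y.
  by apply: has_deriv_on_ext dF => y by_; rewrite expr0 !mul1r.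
rewrite (_ : (fun y => F y ^+ m.+2) = (fun y => F y * F y ^+ m.+1)); last first.
  by apply/funext => y; rewrite -exprS.
apply: has_deriv_on_ext (has_deriv_onM dF IH) => y by_.
rewrite -[in RHS]natr1 exprS; ring.
Qed.

(** is_derive is a limit of quotients in the increment h; here the variable is
    the moving point z = y + h, as in diff_quot. *)
Lemma is_derive_quotP (g : R -> R) y (l : R) :
  (g z - g y) / (z - y) @[z --> y^'] --> l <-> is_derive y 1 g l.
Proof.
have E : (h^-1 *: ((g \o shift y) (h *: 1) - g y) @[h --> 0^'] --> l) <->
    ((g z - g y) / (z - y) @[z --> y^'] --> l).
  have K : forall P : set R, (\forall z \near y^', P z) <->
     (\forall h \near 0^', P (h + y)).
    move=> P.
    suff : (\forall z \near y, z != y -> P z) <->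
           (\forall h \near 0, h != 0 -> P (h + y)) by [].
    apply: (iff_trans (nbhs0P (fun z => z != y -> P z) y)).
    split; apply: filterS => h /= H h0.
      by rewrite addrC; apply: H; rewrite -subr_eq0 addrAC subrr add0r.
    by rewrite addrC; apply: H; apply: contra_neq h0 => ->; rewrite addr0.
  split => + U lU => /(_ U lU) HU.
  - have {}HU : \forall h \near 0^',
        U (h^-1 *: ((g \o shift y) (h *: 1) - g y)).
      exact: HU.
    apply/(K (fun z => U ((g z - g y) / (z - y)))); apply: filterS HU => h /=.
    by rewrite addrK /GRing.scale/= mulr1 mulrC.
  - have {}HU : \forall z \near y^', U ((g z - g y) / (z - y)) by exact: HU.
    suff : \forall h \near 0^',
      U (h^-1 *: ((g \o shift y) (h *: 1) - g y)) by [].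
    move/(K (fun z => U ((g z - g y) / (z - y)))) : HU; apply: filterS => h /=.
    by rewrite addrK /GRing.scale/= mulr1 mulrC.
case: E => E1 E2; split => [/E2 H|[dg dgl]].
- apply: DeriveDef; first by apply/cvg_ex; exists l; exact: H.
  by apply: cvg_lim => //; exact: H.
- by apply: E1; rewrite -dgl; exact: dg.
Qed.

Lemma Re_diff_quot F y z : complex.Re (diff_quot F y z) =
  (complex.Re (F z) - complex.Re (F y)) / (z - y).
Proof.
by rewrite /diff_quot -fmorphV /=; case: (F z) (F y) => [p q] [r t]; simpc.
Qed.

Lemma Im_diff_quot F y z : complex.Im (diff_quot F y z) =
  (complex.Im (F z) - complex.Im (F y)) / (z - y).
Proof.
by rewrite /diff_quot -fmorphV /=; case: (F z) (F y) => [p q] [r t]; simpc.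
Qed.

Lemma has_deriv_on_is_derive b F G y : has_deriv_on b F G -> b < y ->
  is_derive y 1 (fun y => complex.Re (F y)) (complex.Re (G y)) /\
  is_derive y 1 (fun y => complex.Im (F y)) (complex.Im (G y)).
Proof.
move=> dF by_.
have := dF _ (ltW by_); rewrite within_dnbhs_gt// => /cvgC_ReIm[dR dI].
split; apply/is_derive_quotP.
- by under eq_fun do rewrite -Re_diff_quot.
- by under eq_fun do rewrite -Im_diff_quot.
Qed.

Lemma is_derive_has_deriv_on b (u v u' v' : R -> R) :
  (forall y, is_derive y 1 u (u' y)) -> (forall y, is_derive y 1 v (v' y)) ->
  has_deriv_on b (fun y => (u y +i* v y)%C) (fun y => (u' y +i* v' y)%C).
Proof.
move=> du dv y by_; apply/cvgC_ReIm; split; apply: cvg_within_filter.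
- by under eq_fun do rewrite Re_diff_quot; exact/is_derive_quotP.
- by under eq_fun do rewrite Im_diff_quot; exact/is_derive_quotP.
Qed.

End HalfLine.

(** * Improper integrals of functions dominated by a power *)

Section RealIntegrals.
Variable R : realType.
Local Notation mu := (@lebesgue_measure R).
Implicit Types (b s : R).

Lemma powRN_cvgy (t : R) : 0 < t -> y `^ (- t) @[y --> +oo] --> (0 : R).
Proof.
move=> t0; apply/cvgrPdist_lt => e e0; near=> y.
have y0 : 0 < y by near: y; exact: nbhs_pinfty_gt.
rewrite sub0r normrN ger0_norm ?powR_ge0// powRN.
rewrite -[ltRHS]invrK ltf_pV2 ?posrE ?powR_gt0 ?invr_gt0//.
have -> : e^-1 = (e^-1 `^ (t^-1)) `^ t.
  by rewrite -powRrM mulVf ?gt_eqF// powRr1// invr_ge0 ltW.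
apply: gt0_ltr_powR => //; rewrite ?nnegrE ?powR_ge0 ?ltW//.
Unshelve. all: by end_near. Qed.

Lemma within_continuous_powR b (t : R) : 0 < b ->
  {within `[b, +oo[, continuous (fun y : R => y `^ t)}.
Proof.
move=> b0; apply: derivable_within_continuous => y.
rewrite in_itv/= andbT => by_; apply: derivable_powR.
by rewrite in_itv/= andbT (lt_le_trans b0).
Qed.

Lemma continuous_powR (t y : R) : 0 < y ->
  {for y, continuous (fun z : R => z `^ t)}.
Proof.
move=> y0; apply: differentiable_continuous; apply/derivable1_diffP.
by apply: derivable_powR; rewrite in_itv/= andbT.
Qed.

(** This power is both the majorant of every integrand below and, by its
    explicit value, the source of the dependence of the constant on b. *)
Lemma integral_powRN b s : 0 < b -> 1 < s ->
  (\int[mu]_(y in `[b, +oo[) (y `^ (- s))%:E = (b `^ (1 - s) / (s - 1))%:E)%E.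
Proof.
move=> b0 s1.
have s10 : s - 1 != 0 by rewrite subr_eq0 gt_eqF.
have dF (y : R) : 0 < y ->
    is_derive y 1 (fun y => - (s - 1)^-1 * y `^ (1 - s)) (y `^ (- s)).
  move=> y0; have := @is_derive1_powR R (1 - s) y y0.
  move=> /(is_deriveZ (- (s - 1)^-1)) H.
  apply: (is_derive_eq H); rewrite /GRing.scale/= mulrA.
  rewrite (_ : - (s - 1)^-1 * (1 - s) = 1); last by field.
  by rewrite mul1r; congr (_ `^ _); ring.
rewrite (@ge0_continuous_FTC2y _ _ (fun y => - (s - 1)^-1 * y `^ (1 - s)) _ 0).
- by rewrite -EFinB sub0r mulNr opprK mulrC.
- by move=> *; exact: powR_ge0.
- exact: within_continuous_powR.
- rewrite -[X in _ --> X](mulr0 (- (s - 1)^-1)).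
  apply: cvgM; first exact: cvg_cst.
  by rewrite -(opprB s 1); apply: powRN_cvgy; rewrite subr_gt0.
- by move=> y by_; have [] := dF y (lt_trans b0 by_).
- apply: cvg_at_right_filter; apply: cvgM; first exact: cvg_cst.
  exact: continuous_powR.
- move=> y; rewrite in_itv/= andbT => by_.
  by rewrite derive1E; have [_ ->] := dF y (lt_trans b0 by_).
Qed.

Lemma integrable_powRN b s (C : R) : 0 < b -> 1 < s ->
  mu.-integrable `[b, +oo[ (EFin \o (fun y => C * y `^ (- s))).
Proof.
move=> b0 s1.
rewrite (_ : _ \o _ = fun y => (C%:E * (y `^ (- s))%:E)%E); last first.
  by apply/funext.
apply: integrableZl => //; apply/integrableP; split.
  apply/measurable_EFinP; apply: subspace_continuous_measurable_fun => //.
  exact: within_continuous_powR.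
under eq_integral do rewrite gee0_abs ?lee_fin ?powR_ge0//.
by rewrite integral_powRN// ltry.
Qed.

Lemma integrable_dom_powRN b s (C : R) (f : R -> R) : 0 < b -> 1 < s ->
  {within `[b, +oo[, continuous f} ->
  (forall y, b <= y -> `|f y| <= C * y `^ (- s)) ->
  mu.-integrable `[b, +oo[ (EFin \o f).
Proof.
move=> b0 s1 cf fC; apply: le_integrable (integrable_powRN C b0 s1) => //.
  apply/measurable_EFinP; exact: subspace_continuous_measurable_fun.
move=> y /=; rewrite in_itv/= andbT => by_.
by rewrite lee_fin (le_trans (fC _ by_))// ler_norm.
Qed.

Lemma Rintegral_powRN b s (C : R) : 0 < b -> 1 < s ->
  \int[mu]_(y in `[b, +oo[) (C * y `^ (- s)) = C * (b `^ (1 - s) / (s - 1)).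
Proof.
move=> b0 s1; rewrite RintegralZl//; last first.
  have := integrable_powRN 1 b0 s1; congr (_.-integrable _ _).
  by apply/funext => y /=; rewrite mul1r.
by rewrite /Rintegral integral_powRN.
Qed.

Lemma dominated_cvg0 (f : R -> R) (C t : R) : 0 < t ->
  (\forall y \near +oo, `|f y| <= C * y `^ (- t)) ->
  f y @[y --> +oo] --> (0 : R).
Proof.
move=> t0 fC; apply: norm_cvg0.
apply: (@squeeze_cvgr _ _ _ _ (cst 0) (fun y => C * y `^ (- t))).
- by apply: filterS fC => y fCy; rewrite /= normr_ge0.
- exact: cvg_cst.
- rewrite -[X in _ --> X](mulr0 C); apply: cvgM; first exact: cvg_cst.
  exact: powRN_cvgy.
Qed.

(** Reduction to the fundamental theorem for nonnegative integrands: adding the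
    integrable majorant C y^-s, whose primitive is explicit, to f makes it
    nonnegative. *)
Lemma Rintegral_FTC2y b s (C l : R) (f F : R -> R) : 0 < b -> 1 < s ->
  {within `[b, +oo[, continuous f} -> {within `[b, +oo[, continuous F} ->
  (forall y, b < y -> is_derive y 1 F (f y)) ->
  (forall y, b <= y -> `|f y| <= C * y `^ (- s)) ->
  F y @[y --> +oo] --> l ->
  \int[mu]_(y in `[b, +oo[) f y = l - F b.
Proof.
move=> b0 s1 cf cF dF fC Fl.
have s10 : s - 1 != 0 by rewrite subr_eq0 gt_eqF.
(* K is the primitive of the majorant k that vanishes at infinity. *)
pose k y : R := C * y `^ (- s).
pose K (y : R) : R := - (s - 1)^-1 * C * y `^ (1 - s).
have dK (y : R) : 0 < y -> is_derive y 1 K (k y).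
  move=> y0; have := @is_derive1_powR R (1 - s) y y0.
  move=> /(is_deriveZ (- (s - 1)^-1 * C)) H.
  apply: (is_derive_eq H); rewrite /GRing.scale/= mulrA.
  rewrite (_ : - (s - 1)^-1 * C * (1 - s) = C); last by field.
  by rewrite /k; congr (_ * _ `^ _); ring.
have ik : mu.-integrable `[b, +oo[ (EFin \o k) by exact: integrable_powRN.
have if_ : mu.-integrable `[b, +oo[ (EFin \o f).
  exact: integrable_dom_powRN fC.
have ck : {within `[b, +oo[, continuous k}.
  move=> y; apply: cvgM; first exact: cvg_cst.
  exact: within_continuous_powR.
have Ik : \int[mu]_(y in `[b, +oo[) k y = - K b.
  rewrite Rintegral_powRN// /K; by field.
have : \int[mu]_(y in `[b, +oo[) (f y + k y) = l - (F b + K b).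
  apply: (@Rintegral_ge0_continuous_FTC2y _ _ (fun y => F y + K y)).
  - move=> y by_; rewrite -lerBlDr sub0r.
    by have := fC _ by_; rewrite ler_norml => /andP[].
  - by move=> y; apply: cvgD; [exact: cf|exact: ck].
  - rewrite -[X in _ --> X]addr0; apply: cvgD => //.
    rewrite -[X in _ --> X](mulr0 (- (s - 1)^-1 * C)).
    apply: cvgM; first exact: cvg_cst.
    by rewrite -(opprB s 1); apply: powRN_cvgy; rewrite subr_gt0.
  - move=> y by_; apply: derivableD; first by have [] := dF _ by_.
    by have [] := dK _ (lt_trans b0 by_).
  - apply: cvgD.
      by have /continuous_within_itvcyP[] := cF.
    apply: cvg_at_right_filter; apply: cvgM; first exact: cvg_cst.
    exact: continuous_powR.
  - move=> y; rewrite in_itv/= andbT => by_.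
    rewrite derive1E deriveD.
    + by have [_ ->] := dF _ by_; have [_ ->] := dK _ (lt_trans b0 by_).
    + by have [] := dF _ by_.
    + by have [] := dK _ (lt_trans b0 by_).
rewrite RintegralD// Ik => H; lra.
Qed.

End RealIntegrals.

(** * Integrals of dominated complex-valued functions *)

Section ComplexIntegrals.
Variable R : realType.
Local Notation mu := (@lebesgue_measure R).
Local Notation normc := Normc.normc.
Variables (b s : R).
Hypotheses (b0 : 0 < b) (s1 : 1 < s).
Implicit Types (F G g h : R -> R[i]^o) (C : R).

(** Continuity gives measurability and the majorant gives integrability, so
    this one property, stable under linear combinations, stands in for all
    integrability side conditions. *)
Definition dominated_on C g :=
  cont_on b g /\ forall y, b <= y -> normc (g y) <= C * y `^ (- s).

Lemma dominated_on_cintegrable C g : dominated_on C g ->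
  cintegrable `[b, +oo[ g.
Proof.
move=> [cg gC]; split.
- apply: (@integrable_dom_powRN _ b s C (fun y => complex.Re (g y))) => //.
    exact: cont_on_Re.
  by move=> y by_; apply: le_trans (gC _ by_); exact: ler_Re_normc.
- apply: (@integrable_dom_powRN _ b s C (fun y => complex.Im (g y))) => //.
    exact: cont_on_Im.
  by move=> y by_; apply: le_trans (gC _ by_); exact: ler_Im_normc.
Qed.

Lemma dominated_onD C C' g h : dominated_on C g -> dominated_on C' h ->
  dominated_on (C + C') (fun y => g y + h y).
Proof.
move=> [cg gC] [ch hC]; split; first exact: cont_onD cg ch.
move=> y by_; rewrite mulrDl; apply: (le_trans (ler_normcD _ _)).
by apply: lerD; [exact: gC|exact: hC].
Qed.

Lemma dominated_onZ C (c : R[i]^o) g : dominated_on C g ->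
  dominated_on (normc c * C) (fun y => c * g y).
Proof.
move=> [cg gC]; split; first by apply: (cont_onM _ cg); exact: cont_on_cst.
move=> y by_; rewrite Normc.normcM -mulrA ler_wpM2l ?normc_ge0//; exact: gC.
Qed.

Lemma le_normr_Rintegral_powRN C (f : R -> R) :
  {within `[b, +oo[, continuous f} ->
  (forall y, b <= y -> `|f y| <= C * y `^ (- s)) ->
  `|\int[mu]_(y in `[b, +oo[) f y| <= C * (b `^ (1 - s) / (s - 1)).
Proof.
move=> cf fC; have if_ := integrable_dom_powRN b0 s1 cf fC.
apply: (le_trans (le_normr_Rintegral _ _)) => //.
rewrite -Rintegral_powRN//; apply: le_Rintegral => //.
- exact: integrable_norm if_.
- exact: integrable_powRN.
- by move=> y /=; rewrite in_itv/= andbT; exact: fC.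
Qed.

(** The factor 2 is the price of estimating the real and the imaginary
    part separately. *)
Lemma normc_cintegral_le C g : dominated_on C g ->
  normc (cintegral `[b, +oo[ g) <= 2 * C * (b `^ (1 - s) / (s - 1)).
Proof.
move=> [cg gC]; rewrite -mulrA mulr_natl mulr2n.
apply: (le_trans (ler_normc_ReIm _)); apply: lerD.
- apply: le_normr_Rintegral_powRN; first exact: cont_on_Re.
  by move=> y by_; apply: le_trans (gC _ by_); exact: ler_Re_normc.
- apply: le_normr_Rintegral_powRN; first exact: cont_on_Im.
  by move=> y by_; apply: le_trans (gC _ by_); exact: ler_Im_normc.
Qed.

Lemma cintegralD g h : cintegrable `[b, +oo[ g -> cintegrable `[b, +oo[ h ->
  cintegral `[b, +oo[ (fun y => g y + h y) =
  cintegral `[b, +oo[ g + cintegral `[b, +oo[ h.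
Proof.
move=> [gR gI] [hR hI]; rewrite /cintegral; simpc; rewrite -!RintegralD//.
by congr (_ +i* _)%C; apply: eq_Rintegral => y _; rewrite raddfD.
Qed.

Lemma cintegralZ (c : R[i]) g : cintegrable `[b, +oo[ g ->
  cintegral `[b, +oo[ (fun y => c * g y) = c * cintegral `[b, +oo[ g.
Proof.
case: c => u v [gR gI]; rewrite /cintegral; simpc.
have Z (k : R) (f : R -> R) : mu.-integrable `[b, +oo[ (EFin \o f) ->
    mu.-integrable `[b, +oo[ (EFin \o (fun y => k * f y)).
  by move=> /(integrableZl _ k); apply.
congr (_ +i* _)%C; rewrite -!RintegralZl//.
- rewrite -RintegralB//; try exact: Z.
  by apply: eq_Rintegral => y _; case: (g y).
- rewrite -RintegralD//; try exact: Z.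
  by apply: eq_Rintegral => y _; case: (g y).
Qed.

Lemma dominated_cvg0C C t F : 0 < t ->
  (forall y, b <= y -> normc (F y) <= C * y `^ (- t)) ->
  complex.Re (F y) @[y --> +oo] --> (0 : R) /\
  complex.Im (F y) @[y --> +oo] --> (0 : R).
Proof.
move=> t0 FC; split; apply: (@dominated_cvg0 _ _ C t) => //; near=> y.
- apply: le_trans (FC y _); first exact: ler_Re_normc.
  by near: y; apply: nbhs_pinfty_ge; rewrite num_real.
- apply: le_trans (FC y _); first exact: ler_Im_normc.
  by near: y; apply: nbhs_pinfty_ge; rewrite num_real.
Unshelve. all: by end_near. Qed.

(** The majorant of F makes its value at infinity vanish. *)
Lemma cintegral_deriv C C' F G : has_deriv_on b F G ->
  dominated_on C F -> dominated_on C' G ->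
  cintegral `[b, +oo[ G = - F b.
Proof.
move=> dF [cF FC] [cG GC].
have [FR FI] := dominated_cvg0C (lt_trans ltr01 s1) FC.
rewrite /cintegral.
have -> : \int[mu]_(y in `[b, +oo[) complex.Re (G y) = - complex.Re (F b).
  rewrite -[RHS]sub0r.
  apply: (@Rintegral_FTC2y _ b s C' 0 _ (fun y => complex.Re (F y))) => //.
  + exact: cont_on_Re.
  + exact: cont_on_Re.
  + by move=> y by_; have [] := has_deriv_on_is_derive dF by_.
  + by move=> y by_; apply: le_trans (GC _ by_); exact: ler_Re_normc.
have -> : \int[mu]_(y in `[b, +oo[) complex.Im (G y) = - complex.Im (F b).
  rewrite -[RHS]sub0r.
  apply: (@Rintegral_FTC2y _ b s C' 0 _ (fun y => complex.Im (F y))) => //.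
  + exact: cont_on_Im.
  + exact: cont_on_Im.
  + by move=> y by_; have [] := has_deriv_on_is_derive dF by_.
  + by move=> y by_; apply: le_trans (GC _ by_); exact: ler_Im_normc.
by case: (F b).
Qed.

Lemma cvg_Rintegral_at_right C (f : R -> R -> R) (f0 : R -> R) :
  (forall e, 0 < e -> {within `[b, +oo[, continuous (f e)}) ->
  {within `[b, +oo[, continuous f0} ->
  (forall e y, 0 < e -> b <= y -> `|f e y| <= C * y `^ (- s)) ->
  (forall y, b <= y -> f e y @[e --> 0^'+] --> f0 y) ->
  \int[mu]_(y in `[b, +oo[) f e y @[e --> 0^'+] -->
    \int[mu]_(y in `[b, +oo[) f0 y.
Proof.
move=> cf cf0 fC ff0; apply/cvg_at_rightP => u [u0 u_cvg].
have mf (g : R -> R) : {within `[b, +oo[, continuous g} ->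
    measurable_fun `[b, +oo[ (EFin \o g).
  move=> cg; apply/measurable_EFinP; exact: subspace_continuous_measurable_fun.
have [] := @dominated_convergence _ _ _ mu `[b, +oo[%classic _
  (fun n => EFin \o f (u n)) (EFin \o f0) (EFin \o (fun y => C * y `^ (- s))).
- by [].
- by move=> n; apply: mf; exact: cf.
- exact: mf.
- apply: aeW => y /=; rewrite in_itv/= andbT => by_.
  apply: cvg_EFin; first exact: nearW.
  by have /cvg_at_rightP := ff0 y by_; apply.
- exact: integrable_powRN.
- apply: aeW => y n /=; rewrite in_itv/= andbT => by_.
  by rewrite lee_fin; exact: fC.
move=> if0 _ H; apply: fine_cvg; rewrite /Rintegral fineK; first exact: H.
exact: integrable_fin_num.
Qed.

Lemma cvg_cintegral_at_right C (g : R -> R -> R[i]^o) (g0 : R -> R[i]^o) :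
  (forall e, 0 < e -> dominated_on C (g e)) -> cont_on b g0 ->
  (forall y, b <= y -> g e y @[e --> 0^'+] --> g0 y) ->
  cintegral `[b, +oo[ (g e) @[e --> 0^'+] --> cintegral `[b, +oo[ g0.
Proof.
move=> dg cg0 gg0; apply/cvgC_ReIm; split; apply: (@cvg_Rintegral_at_right C).
- by move=> e /dg[cg _]; exact: cont_on_Re.
- exact: cont_on_Re.
- by move=> e y /dg[_ gC] by_; apply: le_trans (gC _ by_); exact: ler_Re_normc.
- by move=> y /gg0 /cvgC_ReIm[].
- by move=> e /dg[cg _]; exact: cont_on_Im.
- exact: cont_on_Im.
- by move=> e y /dg[_ gC] by_; apply: le_trans (gC _ by_); exact: ler_Im_normc.
- by move=> y /gg0 /cvgC_ReIm[].
Qed.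

End ComplexIntegrals.

(** * Growth of the derivatives *)

Section Growth.
Variable R : realType.
Local Notation normc := Normc.normc.
Variables (b alpha : R) (n : nat) (f : R -> R[i]^o).
Hypotheses (b0 : 0 < b) (alpha_ge0 : 0 <= alpha) (fCn : Cn_alpha b n alpha f).
Local Notation fN := (Cn_alpha_norm b n alpha f).
Local Notation "f ^[ k ]" := (derivn_on b k f) (at level 2, format "f ^[ k ]").

Lemma derivn_on_has_deriv k : (k < n)%N -> has_deriv_on b f^[k] f^[k.+1].
Proof. by move=> kn y by_; have [[df _] _] := fCn; exact: df kn y by_. Qed.

Lemma derivn_on_cont k : (k <= n)%N -> cont_on b f^[k].
Proof.
rewrite leq_eqVlt => /predU1P[->|kn].
  by apply/cont_onE; have [[_ cf] _] := fCn.
exact: has_deriv_on_cont (derivn_on_has_deriv kn).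
Qed.

Let S := [set normc (f^[n] y) / y `^ alpha | y in `[b, +oo[].

Let S_ub y : b <= y -> normc (f^[n] y) / y `^ alpha <= sup S.
Proof.
move=> by_; apply: ub_le_sup; last first.
  by exists y => //=; rewrite in_itv/= by_.
have [_ [M M0 fM]] := fCn.
exists M => _ [z/= + <-]; rewrite in_itv/= andbT => bz.
by rewrite ler_pdivrMr ?powR_gt0 ?(lt_le_trans b0)//; exact: fM.
Qed.

Let S_ge0 : 0 <= sup S.
Proof.
apply: le_trans (S_ub (lexx b)).
by rewrite divr_ge0 ?powR_ge0// normc_ge0.
Qed.

Let sum_ge0 (P : pred 'I_n) :
  0 <= \sum_(k < n | P k) normc (f^[k] b) / b `^ ((n - k)%:R + alpha).
Proof.
by apply: sumr_ge0 => k _; rewrite divr_ge0 ?powR_ge0// normc_ge0.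
Qed.

Lemma Cn_alpha_norm_ge0 : 0 <= fN.
Proof. by rewrite addr_ge0. Qed.

Lemma derivn_on_top_le y : b <= y -> normc (f^[n] y) <= fN * y `^ alpha.
Proof.
move=> by_; rewrite -ler_pdivrMr ?powR_gt0 ?(lt_le_trans b0)//.
by apply: (le_trans (S_ub by_)); rewrite lerDr.
Qed.

Lemma derivn_on_left_le k : (k < n)%N ->
  normc (f^[k] b) <= fN * b `^ ((n - k)%:R + alpha).
Proof.
move=> kn; rewrite -ler_pdivrMr ?powR_gt0//.
by rewrite /Cn_alpha_norm (bigD1 (Ordinal kn))//= -addrA lerDl addr_ge0.
Qed.

(** Mean value inequality; it is applied to the real and the imaginary part,
    since there is no mean value theorem for complex values, hence the 2. The
    length y - b of the interval is absorbed into y^(t + 1). *)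
Lemma has_deriv_on_increment_le (F G : R -> R[i]^o) (C t y : R) :
  0 <= C -> 0 <= t ->
  has_deriv_on b F G -> (forall y, b <= y -> normc (G y) <= C * y `^ t) ->
  b <= y -> normc (F y - F b) <= 2 * C * y `^ (t + 1).
Proof.
move=> C0 t0 dF GC by_; have cF := has_deriv_on_cont dF.
have y0 : 0 < y by exact: lt_le_trans by_.
have sub : `[b, y]%classic `<=` (`[b, +oo[%classic : set R).
  by move=> z /=; rewrite !in_itv/= => /andP[-> _].
have inc (u u' : R -> R) : {within `[b, +oo[, continuous u} ->
    (forall z, b < z -> is_derive z 1 u (u' z)) ->
    (forall z, b <= z -> `|u' z| <= C * z `^ t) ->
    `|u y - u b| <= C * y `^ (t + 1).
  move=> cu du uC.
  have [//|z||c] := @MVT_segment _ u u' b y.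
  - by rewrite in_itv/= => /andP[bz _]; exact: du.
  - exact: continuous_subspaceW cu.
  rewrite in_itv/= => /andP[bc cy] ->; rewrite normrM.
  rewrite powRD ?(gt_eqF y0) ?implybT// (powRr1 (ltW y0)) mulrA.
  apply: ler_pM => //.
  - apply: (le_trans (uC _ bc)); apply: ler_wpM2l => //.
    by apply: ge0_ler_powR => //; rewrite nnegrE ltW// (lt_le_trans b0).
  - by rewrite ger0_norm ?subr_ge0// gerBl ltW.
rewrite -mulrA mulr_natl mulr2n (le_trans (ler_normc_ReIm _))// !raddfB.
apply: lerD.
- apply: (inc (fun y => complex.Re (F y)) (fun y => complex.Re (G y))).
  + exact: cont_on_Re.
  + by move=> z bz; have [] := has_deriv_on_is_derive dF bz.
  + by move=> z bz; apply: le_trans (GC _ bz); exact: ler_Re_normc.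
- apply: (inc (fun y => complex.Im (F y)) (fun y => complex.Im (G y))).
  + exact: cont_on_Im.
  + by move=> z bz; have [] := has_deriv_on_is_derive dF bz.
  + by move=> z bz; apply: le_trans (GC _ bz); exact: ler_Im_normc.
Qed.

(** Descending from the n-th derivative, each step adds the value at b,
    controlled by the corresponding term of the norm, to an increment bounded by
    the mean value inequality. The constants must satisfy K(0) >= 1 and
    K(k+1) >= 1 + 2 K(k); the choice is K(k) = 3^k. *)
Lemma derivn_on_growth k y : (k <= n)%N -> b <= y ->
  normc (f^[n - k] y) <= 3 ^+ k * fN * y `^ (k%:R + alpha).
Proof.
elim: k y => [|k IH] y kn by_.
  by rewrite subn0 expr0 mul1r add0r; exact: derivn_on_top_le.
have kn' : (n - k.+1 < n)%N by rewrite ltn_subrL (leq_ltn_trans _ kn).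
have y0 : 0 < y by exact: lt_le_trans by_.
have := derivn_on_has_deriv kn'; rewrite -subSn// subSS => dF.
have fN0 := Cn_alpha_norm_ge0.
have ke : k%:R + alpha + 1 = k.+1%:R + alpha by rewrite -addn1 natrD; ring.
have := has_deriv_on_increment_le _ _ dF (fun y => IH y (ltnW kn)) by_.
rewrite mulr_ge0 ?exprn_ge0// addr_ge0// ke => /(_ isT isT) H.
have H2 : normc (f^[n - k.+1] b) <= fN * y `^ (k.+1%:R + alpha).
  apply: (le_trans (derivn_on_left_le kn')); rewrite subKn//.
  apply: ler_wpM2l => //.
  by apply: ge0_ler_powR; rewrite ?nnegrE ?addr_ge0// ltW.
have -> : f^[n - k.+1] y = (f^[n - k.+1] y - f^[n - k.+1] b) + f^[n - k.+1] b.
  by rewrite subrK.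
apply: (le_trans (ler_normcD _ _)); apply: (le_trans (lerD H H2)).
rewrite !mulrA -mulrDl; apply: ler_wpM2r; first exact: powR_ge0.
rewrite -[X in _ + X]mul1r -mulrDl; apply: ler_wpM2r => //.
rewrite exprS; have : 1 <= 3 ^+ k :> R by rewrite exprn_ege1// ler1n.
lra.
Qed.

End Growth.

(** * The exponential factor and its phase *)

Section Phase.
Variable R : realType.
Local Notation normc := Normc.normc.
Implicit Types (a b eps y : R).

(** e^psi with psi(y) = - eps (y - y0)^2 + i a y^2. *)
Definition damped_wave a y0 eps y : R[i]^o :=
  (expR (- eps * (y - y0) ^+ 2))%:C%C * expi (a * y ^+ 2).

(** The derivative psi' of the phase. *)
Definition dphase a y0 eps y : R[i]^o :=
  (- 2 * eps * (y - y0) +i* (2 * a * y))%C.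

(** The constant psi''. *)
Definition ddphase a eps : R[i]^o := (- 2 * eps +i* (2 * a))%C.

Lemma damped_waveE a y0 eps y : damped_wave a y0 eps y =
  (expR (- eps * (y - y0) ^+ 2) * cos (a * y ^+ 2) +i*
   (expR (- eps * (y - y0) ^+ 2) * sin (a * y ^+ 2)))%C.
Proof. by rewrite /damped_wave /expi; simpc. Qed.

Lemma normc_damped_wave a y0 eps y :
  normc (damped_wave a y0 eps y) = expR (- eps * (y - y0) ^+ 2).
Proof. by rewrite Normc.normcM normc_expi mulr1 normcR ger0_norm ?expR_ge0. Qed.

Lemma damped_wave_deriv a b y0 eps : has_deriv_on b (damped_wave a y0 eps)
  (fun y => dphase a y0 eps y * damped_wave a y0 eps y).
Proof.
have dg y : is_derive y 1 (fun y => - eps * (y - y0) ^+ 2)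
    (- 2 * eps * (y - y0)).
  apply: is_derive_eq; rewrite /GRing.scale/= ?scaler0; ring.
have dE y : is_derive y 1 (fun y => expR (- eps * (y - y0) ^+ 2))
    (- 2 * eps * (y - y0) * expR (- eps * (y - y0) ^+ 2)).
  apply: is_derive_eq; rewrite /GRing.scale/=; ring.
have dt y : is_derive y 1 (fun y => a * y ^+ 2) (2 * a * y).
  apply: is_derive_eq; rewrite /GRing.scale/= ?scaler0; ring.
have dc y : is_derive y 1 (fun y => cos (a * y ^+ 2))
    (- (2 * a * y) * sin (a * y ^+ 2)).
  apply: is_derive_eq; rewrite /GRing.scale/=; ring.
have ds y : is_derive y 1 (fun y => sin (a * y ^+ 2))
    (2 * a * y * cos (a * y ^+ 2)).
  apply: is_derive_eq; rewrite /GRing.scale/=; ring.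
rewrite (_ : damped_wave a y0 eps = (fun y =>
  (expR (- eps * (y - y0) ^+ 2) * cos (a * y ^+ 2) +i*
   (expR (- eps * (y - y0) ^+ 2) * sin (a * y ^+ 2)))%C)); last first.
  by apply/funext => y; exact: damped_waveE.
pose u' y := expR (- eps * (y - y0) ^+ 2) * (- (2 * a * y) * sin (a * y ^+ 2)) +
  cos (a * y ^+ 2) * (- 2 * eps * (y - y0) * expR (- eps * (y - y0) ^+ 2)).
pose v' y := expR (- eps * (y - y0) ^+ 2) * (2 * a * y * cos (a * y ^+ 2)) +
  sin (a * y ^+ 2) * (- 2 * eps * (y - y0) * expR (- eps * (y - y0) ^+ 2)).
have H := @is_derive_has_deriv_on R b _ _ u' v'
  (fun y => is_deriveM (dE y) (dc y)) (fun y => is_deriveM (dE y) (ds y)).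
apply: has_deriv_on_ext H => y _.
rewrite /dphase /u' /v'.
move: (expR _) (cos _) (sin _) => E c t; simpc.
apply/eqP; rewrite eq_complex /=; apply/andP; split; apply/eqP; ring.
Qed.

Lemma dphase_deriv a b y0 eps :
  has_deriv_on b (dphase a y0 eps) (fun=> ddphase a eps).
Proof.
apply: is_derive_has_deriv_on => y; apply: is_derive_eq;
  rewrite /GRing.scale/= ?scaler0.

all: ring.
Qed.

Lemma dphase_neq0 a y0 eps y : a != 0 -> 0 < y -> dphase a y0 eps y != 0.
Proof.
move=> a0 y_gt0; rewrite eq_complex/= negb_and; apply/orP; right.
by rewrite !mulf_neq0// gt_eqF.
Qed.

(** The Gaussian only contributes to the real part of psi', so the imaginary
    part 2 a y alone bounds psi' away from 0, whatever eps and y0. *)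
Lemma normc_dphaseV a y0 eps y : a != 0 -> 0 < y ->
  normc (dphase a y0 eps y)^-1 <= (2 * `|a| * y)^-1.
Proof.
move=> a0 y_gt0; rewrite Normc.normcV.
have H : 2 * `|a| * y <= normc (dphase a y0 eps y).
  apply: le_trans (ler_Im_normc _) => /=.
  by rewrite !normrM (ger0_norm (ltW y_gt0)) normr_nat.
have a_gt0 : 0 < `|a| by rewrite normr_gt0.
have : 0 < 2 * `|a| * y by rewrite !mulr_gt0.
by move=> H0; rewrite lef_pV2// posrE// (lt_le_trans H0).
Qed.

Lemma normc_ddphase a eps : 0 <= eps -> eps <= 1 ->
  normc (ddphase a eps) <= 2 * (`|a| + 1).
Proof.
move=> e0 e1; apply: (le_trans (ler_normc_ReIm _)) => /=.
rewrite !normrM normrN normr_nat (ger0_norm e0); lra.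
Qed.

(** By eps (y - y0)^2 >= y - y0 - 1 / (4 eps), a completed square, the
    Gaussian is at most a constant times e^-y, and e^y >= y^(N+1) / (N+1)!. *)
Lemma gaussian_le y0 eps N : 0 < eps ->
  exists2 C : R, 0 <= C &
    forall y, 0 < y -> expR (- eps * (y - y0) ^+ 2) <= C * y `^ (- N.+1%:R).
Proof.
move=> e0; exists (expR (y0 + (4 * eps)^-1) * N.+1`!%:R).
  by rewrite mulr_ge0 ?expR_ge0.
move=> y y_gt0; rewrite powR_invn ?(ltW y_gt0)//.
have H : - eps * (y - y0) ^+ 2 <= y0 + (4 * eps)^-1 - y.
  rewrite -subr_ge0.
  have -> : y0 + (4 * eps)^-1 - y - - eps * (y - y0) ^+ 2 =
      eps * (y - y0 - (2 * eps)^-1) ^+ 2.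
    by field; rewrite gt_eqF.
  by rewrite mulr_ge0 ?sqr_ge0 ?ltW.
apply: (@le_trans _ _ (expR (y0 + (4 * eps)^-1 - y))).
  by rewrite ler_expR.
rewrite expRD expRN -mulrA ler_wpM2l ?expR_ge0//.
rewrite -[leRHS]invrK lef_pV2 ?posrE ?expR_gt0 ?invr_gt0 ?mulr_gt0
  ?invr_gt0 ?exprn_gt0 ?ltr0n ?fact_gt0//.
rewrite invfM invrK mulrC.
by apply: le_trans (expR_ge1Dxn N (ltW y_gt0)); rewrite lerDr.
Qed.

Lemma cvg_damped_wave a y0 y :
  damped_wave a y0 eps y @[eps --> 0^'+] --> damped_wave a y0 0 y.
Proof.
apply: cvgM; last exact: cvg_cst.
apply/cvgC_ReIm; split => /=; last exact: cvg_cst.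
apply: cvg_at_right_filter.
apply: (@continuous_comp _ _ _ (fun eps => - eps * (y - y0) ^+ 2) expR).
  by apply: cvgM; [apply: cvgN; exact: cvg_id|exact: cvg_cst].
exact: continuous_expR.
Qed.

Lemma cvg_dphase a y0 y : dphase a y0 eps y @[eps --> 0^'+] --> dphase a y0 0 y.
Proof.
apply/cvgC_ReIm; split => /=; last exact: cvg_cst.
apply: cvg_at_right_filter; apply: cvgM; last exact: cvg_cst.
by apply: cvgM; [exact: cvg_cst|exact: cvg_id].
Qed.

Lemma cvg_ddphase a : ddphase a eps @[eps --> 0^'+] --> ddphase a 0.
Proof.
apply/cvgC_ReIm; split => /=; last exact: cvg_cst.
by apply: cvg_at_right_filter; apply: cvgM; [exact: cvg_cst|exact: cvg_id].
Qed.

Lemma damped_wave0 a y0 y : damped_wave a y0 0 y = damped_wave a 0 0 y.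
Proof. by rewrite /damped_wave oppr0 !mul0r. Qed.

Lemma dphase0 a y0 y : dphase a y0 0 y = dphase a 0 0 y.
Proof. by rewrite /dphase !mulr0 !mul0r. Qed.

End Phase.

(** * Repeated integration by parts *)

Section Oscillatory.
Variable R : realType.
Local Notation normc := Normc.normc.

Definition osc_integrand (b : R) (f : R -> R[i]^o) (a y0 eps : R) (m j : nat) :
    R -> R[i]^o := fun y =>
  damped_wave a y0 eps y * (dphase a y0 eps y)^-1 ^+ m * derivn_on b j f y.

Definition osc_term (b : R) f (a y0 eps : R) m j : R[i]^o :=
  cintegral `[b, +oo[ (osc_integrand b f a y0 eps m j).

Section Fixed.
Variables (n : nat) (alpha a b : R) (f : R -> R[i]^o).
Hypotheses (alpha_ge0 : 0 <= alpha) (n_gt : alpha + 1 < n%:R).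
Hypotheses (a0 : a != 0) (b0 : 0 < b) (fCn : Cn_alpha b n alpha f).
Local Notation fN := (Cn_alpha_norm b n alpha f).
Local Notation s := (n%:R - alpha).
Local Notation g := (osc_integrand b f a).
Local Notation J := (osc_term b f a).

Let s1 : 1 < s. Proof. by rewrite ltrBrDl. Qed.

Let fN0 : 0 <= fN. Proof. exact: Cn_alpha_norm_ge0. Qed.

Lemma osc_integrand_cont y0 eps m j : (j <= n)%N -> cont_on b (g y0 eps m j).
Proof.
move=> jn; apply: cont_onM; last exact: (derivn_on_cont fCn jn).
apply: cont_onM.
  apply: has_deriv_on_cont; exact: damped_wave_deriv.
apply: cont_onX; apply: has_deriv_on_cont.
apply: has_deriv_onV; last exact: dphase_deriv.
by move=> y by_; apply: dphase_neq0 => //; exact: (lt_le_trans b0 by_).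
Qed.

Lemma normc_osc_integrand y0 eps m j y : (j <= n)%N -> b <= y ->
  normc (g y0 eps m j y) <=
    expR (- eps * (y - y0) ^+ 2) * (2 * `|a| * y)^-1 ^+ m *
    (3 ^+ (n - j) * fN * y `^ ((n - j)%:R + alpha)).
Proof.
move=> jn by_; have y_gt0 := lt_le_trans b0 by_.
rewrite /osc_integrand 2!Normc.normcM normc_damped_wave normcX.
apply: ler_pM; rewrite ?mulr_ge0 ?exprn_ge0 ?normc_ge0 ?expR_ge0//.
  rewrite ler_wpM2l ?expR_ge0// lerXn2r ?nnegrE ?normc_ge0//; last first.
    exact: normc_dphaseV.
  by rewrite invr_ge0 !mulr_ge0// ltW.
rewrite -[in leLHS](subKn jn); apply: derivn_on_growth => //; exact: leq_subr.
Qed.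

(** The Gaussian beats any power of y. The constant degenerates as eps tends
    to 0 and serves only to justify the integration by parts. *)
Lemma osc_integrand_dominated y0 eps m j : 0 < eps -> (j <= n)%N ->
  exists C, dominated_on b s C (g y0 eps m j).
Proof.
move=> e0 jn.
have n0 : (0 < n)%N.
  by case: n n_gt => // H; move: H; rewrite ltNge addr_ge0.
(* The exponent 2n - j brings y^(n - j + alpha) down to y^(alpha - n). *)
have [C C0 HC] := gaussian_le y0 (n + n - j).-1 e0.
have E : (n + n - j).-1.+1 = (n + n - j)%N by lia.
rewrite E in HC.
exists (C * (2 * `|a| * b)^-1 ^+ m * (3 ^+ (n - j) * fN)).
split; first exact: osc_integrand_cont.
move=> y by_; have y_gt0 := lt_le_trans b0 by_.
apply: (le_trans (normc_osc_integrand _ _ _ jn by_)).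
have a_gt0 : 0 < `|a| by rewrite normr_gt0.
have -> : - (n%:R - alpha) = - (n + n - j)%:R + ((n - j)%:R + alpha) :> R.
  by rewrite !natrB ?natrD//; [ring|lia].
rewrite [in leRHS]powRD; last by rewrite (gt_eqF y_gt0) implybT.
set G := expR _; set p := y `^ (- _); set q := y `^ _.
have -> : C * (2 * `|a| * b)^-1 ^+ m * (3 ^+ (n - j) * fN) * (p * q) =
  (C * p) * (2 * `|a| * b)^-1 ^+ m * (3 ^+ (n - j) * fN * q) by ring.
apply: ler_wpM2r; first by rewrite !mulr_ge0 ?exprn_ge0 ?powR_ge0.
apply: ler_pM; rewrite ?expR_ge0 ?exprn_ge0 ?invr_ge0 ?mulr_ge0 ?(ltW y_gt0)//.
  exact: HC.
rewrite lerXn2r ?nnegrE ?invr_ge0 ?mulr_ge0 ?(ltW y_gt0) ?(ltW b0)//.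
by rewrite lef_pV2 ?posrE ?mulr_gt0// ler_wpM2l// mulr_ge0.
Qed.

(** For m + j = 2n the powers of y add up to - m + (n - j) + alpha =
    alpha - n, without any help from the Gaussian: hence the uniformity. *)
Lemma osc_integrand_unif_dominated y0 eps m j :
  0 <= eps -> (m + j = n + n)%N -> (j <= n)%N ->
  dominated_on b s ((2 * `|a|)^-1 ^+ m * 3 ^+ (n - j) * fN) (g y0 eps m j).
Proof.
move=> e0 mj jn; split; first exact: osc_integrand_cont.
move=> y by_; have y_gt0 := lt_le_trans b0 by_.
apply: (le_trans (normc_osc_integrand _ _ _ jn by_)).
have -> : - (n%:R - alpha) = - m%:R + ((n - j)%:R + alpha) :> R.
  rewrite (_ : m = n + (n - j))%N; last lia.
  by rewrite natrD natrB//; ring.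
rewrite [in leRHS]powRD; last by rewrite (gt_eqF y_gt0) implybT.
rewrite powR_invn ?(ltW y_gt0)// invfM exprMn -exprVn.
set q := y `^ _; set u := (2 * `|a|)^-1 ^+ m; set v := y^-1 ^+ m.
have -> : u * 3 ^+ (n - j) * fN * (v * q) =
  (1 * (u * v)) * (3 ^+ (n - j) * fN * q) by ring.
apply: ler_wpM2r; first by rewrite !mulr_ge0 ?exprn_ge0 ?powR_ge0.
apply: ler_wpM2r.
  by rewrite mulr_ge0 ?exprn_ge0 ?invr_ge0 ?mulr_ge0 ?(ltW y_gt0).
by rewrite -expR0 ler_expR mulNr oppr_le0 mulr_ge0 ?sqr_ge0.
Qed.

(** The function differentiated is e^psi (1 / psi')^(m+1) f^(j); its
    derivative has three terms, (e^psi)' = psi' e^psi cancelling one factor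
    1 / psi', and ((1 / psi')^(m+1))' = - (m+1) psi'' (1 / psi')^(m+2). *)
Lemma osc_term_step y0 eps m j : 0 < eps -> (j < n)%N ->
  J y0 eps m j = - g y0 eps m.+1 j b - J y0 eps m.+1 j.+1 +
    m.+1%:R * ddphase a eps * J y0 eps m.+2 j.
Proof.
move=> e0 jn.
have [C1 d1] := osc_integrand_dominated y0 m e0 (ltnW jn).
have [C2 d2] := osc_integrand_dominated y0 m.+1 e0 jn.
have [C3 d3] := osc_integrand_dominated y0 m.+2 e0 (ltnW jn).
have [C4 d4] := osc_integrand_dominated y0 m.+1 e0 (ltnW jn).
set k := m.+1%:R * ddphase a eps.
pose G y := g y0 eps m j y + (g y0 eps m.+1 j.+1 y + - k * g y0 eps m.+2 j y).
have dG : has_deriv_on b (g y0 eps m.+1 j) G.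
  have w0 y : b <= y -> dphase a y0 eps y != 0.
    by move=> by_; apply: dphase_neq0 => //; exact: (lt_le_trans b0 by_).
  have dw := @has_deriv_onXS R b _ _ m
    (has_deriv_onV w0 (@dphase_deriv R a b y0 eps)).
  have dkw := has_deriv_onM (@damped_wave_deriv R a b y0 eps) dw.
  have dT := has_deriv_onM dkw (derivn_on_has_deriv fCn jn).
  apply: has_deriv_on_ext dT => y by_.
  rewrite /G /osc_integrand /k !exprS expr0; field; exact: w0.
have d3k := dominated_onZ (- k) d3.
have d23 := dominated_onD d2 d3k.
have := cintegral_deriv b0 s1 dG d4 (dominated_onD d1 d23).
have i1 := dominated_on_cintegrable b0 s1 d1.
have i2 := dominated_on_cintegrable b0 s1 d2.
have i3 := dominated_on_cintegrable b0 s1 d3.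
have i3k := dominated_on_cintegrable b0 s1 d3k.
have i23 := dominated_on_cintegrable b0 s1 d23.
rewrite /G cintegralD// cintegralD// cintegralZ//.
rewrite -!/(osc_term _ _ _ _ _ _ _) => H.
rewrite -H; ring.
Qed.

(** The bound obtained by taking norms in osc_term_step d times, down to the
    terminal integrals; the index d is tied to m and j by m + j + 2d = 2n. *)
Fixpoint osc_const (d m j : nat) (a b : R) : R :=
  if d is d'.+1 then
    (2 * `|a| * b)^-1 ^+ m.+1 * (3 ^+ (n - j) * b `^ ((n - j)%:R + alpha)) +
    osc_const d' m.+1 j.+1 a b +
    m.+1%:R * (2 * (`|a| + 1)) * osc_const d' m.+2 j a b
  else 2 * ((2 * `|a|)^-1 ^+ m * 3 ^+ (n - j)) * (b `^ (1 - s) / (s - 1)).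

Lemma osc_term_le y0 eps d m j : 0 < eps -> eps <= 1 ->
  (m + j + d.*2 = n + n)%N -> (j + d <= n)%N ->
  normc (J y0 eps m j) <= osc_const d m j a b * fN.
Proof.
move=> e0 e1; elim: d m j => [|d IH] m j mj jn; rewrite [osc_const _ _ _ _ _]/=.
  have H := @osc_integrand_unif_dominated y0 eps m j (ltW e0) _ _.
  apply: (le_trans (normc_cintegral_le b0 s1 (H _ _))); [lia|lia|].
  by rewrite le_eqVlt; apply/orP; left; apply/eqP; ring.
rewrite osc_term_step//; last lia.
apply: (le_trans (ler_normcD _ _)); rewrite 2!mulrDl; apply: lerD.
  apply: (le_trans (ler_normcD _ _)); rewrite !normcN; apply: lerD.
    apply: (le_trans (normc_osc_integrand _ _ _ _ (lexx b))); first lia.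
    set q := b `^ _; set u := (_)^-1 ^+ _.
    have -> : u * (3 ^+ (n - j) * q) * fN = 1 * u * (3 ^+ (n - j) * fN * q).
      by ring.
    apply: ler_wpM2r; first by rewrite !mulr_ge0 ?exprn_ge0 ?powR_ge0.
    apply: ler_wpM2r; first by rewrite exprn_ge0 ?invr_ge0 ?mulr_ge0 ?(ltW b0).
    by rewrite -expR0 ler_expR mulNr oppr_le0 mulr_ge0 ?sqr_ge0// ltW.
  by apply: IH; lia.
rewrite !Normc.normcM -(mulrA (m.+1%:R * _)).
apply: ler_pM; rewrite ?mulr_ge0 ?normc_ge0//.
  have -> : normc (m.+1%:R : R[i]) = m.+1%:R.
    by rewrite -(rmorph_nat (real_complex R)) normcR normr_nat.
  by rewrite ler_wpM2l// normc_ddphase// ltW.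
by apply: IH; lia.
Qed.

(** At eps = 0 the phase, hence every boundary value and every terminal
    integral, is free of y0; the limit L is built before y0 is chosen. *)
Lemma osc_term_cvg d m j : (m + j + d.*2 = n + n)%N -> (j + d <= n)%N ->
  exists L : R[i]^o, forall y0, J y0 eps m j @[eps --> 0^'+] --> L.
Proof.
have cvg_g y0 m' j' y : b <= y ->
    g y0 eps m' j' y @[eps --> 0^'+] --> g 0 0 m' j' y.
  move=> by_; have y_gt0 := lt_le_trans b0 by_.
  rewrite /osc_integrand -(damped_wave0 a y0) -(dphase0 a y0).
  apply: cvgM; last exact: cvg_cst.
  apply: cvgM; first exact: cvg_damped_wave.
  apply: cvgC_X; apply: cvgV; first exact: dphase_neq0.
  exact: cvg_dphase.
elim: d m j => [|d IH] m j mj jn.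
  exists (J 0 0 m j) => y0; apply: (cvg_cintegral_at_right b0 s1).
  - by move=> e e0; apply: osc_integrand_unif_dominated; [exact: ltW|lia|lia].
  - by apply: osc_integrand_cont; lia.
  - by move=> y by_; exact: cvg_g.
have [L1 JL1] : exists L : R[i]^o, forall y0,
    J y0 eps m.+1 j.+1 @[eps --> 0^'+] --> L.
  by apply: IH; lia.
have [L2 JL2] : exists L : R[i]^o, forall y0,
    J y0 eps m.+2 j @[eps --> 0^'+] --> L.
  by apply: IH; lia.
exists (- g 0 0 m.+1 j b - L1 + m.+1%:R * ddphase a 0 * L2) => y0.
have : - g y0 eps m.+1 j b - J y0 eps m.+1 j.+1 +
    m.+1%:R * ddphase a eps * J y0 eps m.+2 j @[eps --> 0^'+] -->
    - g 0 0 m.+1 j b - L1 + m.+1%:R * ddphase a 0 * L2.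
  apply: cvgD.
    have cg := cvg_g y0 m.+1 j b (lexx b).
    exact: (cvgB (cvgN cg) (JL1 y0)).
  apply: cvgM; last exact: JL2.
  by apply: cvgM; [exact: cvg_cst|exact: cvg_ddphase].
apply: cvg_trans; apply: near_eq_cvg; near=> eps.
have e0 : 0 < eps by near: eps; exact: nbhs_right_gt.
have jn' : (j < n)%N by lia.
by rewrite (osc_term_step y0 m e0 jn').
Unshelve. all: by end_near. Qed.

End Fixed.
End Oscillatory.

(** * Dependence of the constant on the parameters *)

Section ConstantProperties.
Variables (R : realType) (n : nat) (alpha : R).
Hypothesis n_gt : alpha + 1 < n%:R.
Local Notation K := (osc_const n alpha).

Let s1 : 0 < n%:R - alpha - 1. Proof. by rewrite subr_gt0 ltrBrDl. Qed.

Lemma osc_const_ge0 d m j (a b : R) : a != 0 -> 0 < b -> 0 <= K d m j a b.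
Proof.
move=> a0 b0; elim: d m j => [|d IH] m j /=.
  by rewrite !mulr_ge0 ?exprn_ge0 ?invr_ge0 ?mulr_ge0 ?powR_ge0 ?(ltW s1).
by rewrite !addr_ge0 ?mulr_ge0 ?exprn_ge0 ?invr_ge0 ?mulr_ge0 ?powR_ge0
  ?addr_ge0 ?(ltW b0).
Qed.

Lemma osc_const_continuous d m j (p : R * R) : p.1 != 0 -> 0 < p.2 ->
  {for p, continuous (fun p => K d m j p.1 p.2)}.
Proof.
move=> p1 p2.
have c1 : `|q.1| @[q --> p] --> `|p.1| by apply: cvg_norm; exact: cvg_fst.
have c2 (t : R) : q.2 `^ t @[q --> p] --> p.2 `^ t.
  apply: (@continuous_comp _ _ _ (fun q : R * R => q.2) (fun y => y `^ t)).
    exact: cvg_snd.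
  exact: continuous_powR.
have cX (F : R * R -> R) k : F q @[q --> p] --> F p ->
    F q ^+ k @[q --> p] --> F p ^+ k.
  move=> cF; apply: (@continuous_comp _ _ _ F (fun y => y ^+ k)) => //.
  exact: exprn_continuous.
rewrite /continuous_at; elim: d m j => [|d IH] m j /=.
  apply: cvgM; last by apply: cvgM; [exact: c2|exact: cvg_cst].
  apply: cvgM; first exact: cvg_cst.
  apply: cvgM; last exact: cvg_cst.
  apply: cX; apply: cvgV; first by rewrite mulf_neq0 ?normr_eq0.
  by apply: cvgM; [exact: cvg_cst|exact: c1].
apply: cvgD; first apply: cvgD; [|exact: IH|].
  apply: cvgM; last by apply: cvgM; [exact: cvg_cst|exact: c2].
  apply: cX; apply: cvgV; first by rewrite !mulf_neq0 ?normr_eq0 ?(gt_eqF p2).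
  by apply: cvgM; [apply: cvgM; [exact: cvg_cst|exact: c1]|exact: cvg_snd].
apply: cvgM; last exact: IH.
apply: cvgM; first exact: cvg_cst.
apply: cvgM; first exact: cvg_cst.
by apply: cvgD; [exact: c1|exact: cvg_cst].
Qed.

(** Every term of osc_const carries at least m factors 1 / |a|; a boundary
    value has m + 1 of them, and so do the two recursive terms, the second
    because psi'' costs one power of |a| but m grows by 2. Thus one unfolding
    already gains a factor. *)
Lemma osc_const_decay d m j (b : R) : 0 < b ->
  exists2 C, 0 <= C & forall a : R, 1 <= `|a| ->
    K d m j a b <= C * `|a|^-1 ^+ (m + (0 < d)%N).
Proof.
move=> b0; elim: d m j => [|d IH] m j /=.
  exists (2 * (2^-1 ^+ m * 3 ^+ (n - j)) *
    (b `^ (1 - (n%:R - alpha)) / (n%:R - alpha - 1))).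
    by rewrite !mulr_ge0 ?exprn_ge0 ?invr_ge0 ?powR_ge0 ?(ltW s1).
  move=> a a1; rewrite addn0 invfM exprMn.
  by rewrite le_eqVlt; apply/orP; left; apply/eqP; ring.
have [C1 C10 H1] := IH m.+1 j.+1; have [C2 C20 H2] := IH m.+2 j.
exists ((2 * b)^-1 ^+ m.+1 * (3 ^+ (n - j) * b `^ ((n - j)%:R + alpha)) + C1 +
   m.+1%:R * 4 * C2).
  by rewrite !addr_ge0 ?mulr_ge0 ?exprn_ge0 ?invr_ge0 ?mulr_ge0 ?powR_ge0
    ?(ltW b0).
move=> a a1; rewrite addn1.
have a_gt0 : 0 < `|a| by exact: lt_le_trans a1.
have ai1 : `|a|^-1 <= 1 by rewrite invf_le1.
have ai0 : 0 <= `|a|^-1 by rewrite invr_ge0.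
have le_pow k l : (k <= l)%N -> `|a|^-1 ^+ l <= `|a|^-1 ^+ k.
  by move=> kl; apply: ler_wiXn2l.
rewrite (mulrDl _ (_ * 4 * C2)) (mulrDl _ C1); apply: lerD; first apply: lerD.
- rewrite mulrAC (mulrC 2) invfM mulrAC -mulrA invfM.
  by rewrite !exprMn le_eqVlt; apply/orP; left; apply/eqP; ring.
- by apply: (le_trans (H1 a a1)); rewrite ler_wpM2l// le_pow// leq_addr.
- have H : K d m.+2 j a b <= C2 * `|a|^-1 ^+ m.+2.
    by apply: (le_trans (H2 a a1)); rewrite ler_wpM2l// le_pow// leq_addr.
  apply: (@le_trans _ _ (m.+1%:R * (4 * `|a|) * (C2 * `|a|^-1 ^+ m.+2))).
    apply: ler_pM => //.
    + by apply: osc_const_ge0; rewrite -?normr_gt0.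
    + by rewrite ler_wpM2l//; lra.
  rewrite le_eqVlt; apply/orP; left; apply/eqP; rewrite (exprS _ m.+1).
  by field; rewrite gt_eqF.
Qed.

End ConstantProperties.

(** * The regularized integrals *)

Theorem theorem3p3 (R : realType) (n : nat) (alpha : R)
    (alpha_ge0 : 0 <= alpha) (n_gt : alpha + 1 < n%:R) :
  (forall (a b : R) (f : R -> R[i]^o), a != 0 -> 0 < b -> Cn_alpha b n alpha f ->
     (forall y0 eps : R, 0 < eps ->
        cintegrable `[b, +oo[ (reg_integrand a y0 f eps)) /\
     (forall y0 : R, cvg (reg_int a b y0 f eps @[eps --> 0^'+])) /\
     (forall y0 y1 : R, osc_int a b y0 f = osc_int a b y1 f)) /\
  (exists D : R -> R -> R,
     (forall a b : R, a != 0 -> 0 < b -> 0 <= D a b) /\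
     (forall (a b : R) (f : R -> R[i]^o) (y0 eps : R),
        a != 0 -> 0 < b -> Cn_alpha b n alpha f -> 0 < eps -> eps <= 1 ->
        Normc.normc (reg_int a b y0 f eps) <= D a b * Cn_alpha_norm b n alpha f /\
        Normc.normc (osc_int a b y0 f) <= D a b * Cn_alpha_norm b n alpha f) /\
     {within [set p : R * R | p.1 != 0 /\ 0 < p.2],
        continuous (fun p : R * R => D p.1 p.2)} /\
     (forall b : R, 0 < b ->
        exists C A : R, forall a : R, A <= `|a| -> `|D a b| <= C * `|a|^-1)).
Proof.
have n0 : (0 < n)%N by case: n n_gt => // H; move: H; rewrite ltNge addr_ge0.
have integrandE (a b y0 : R) f eps :
    reg_integrand a y0 f eps = osc_integrand b f a y0 eps 0 0.
  by apply/funext => y; rewrite /osc_integrand expr0 mulr1.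
have regE (a b y0 : R) f eps : reg_int a b y0 f eps = osc_term b f a y0 eps 0 0.
  by rewrite /reg_int (integrandE a b).
have lim_reg (a b : R) f : a != 0 -> 0 < b -> Cn_alpha b n alpha f ->
    exists L : R[i]^o, forall y0, reg_int a b y0 f eps @[eps --> 0^'+] --> L.
  move=> a0 b0 fCn.
  have [|//|L HL] :=
    @osc_term_cvg R n alpha a b f alpha_ge0 n_gt a0 b0 fCn n 0 0.
    by rewrite -addnn.
  by exists L => y0; under eq_fun do rewrite regE; exact: HL.
split.
  move=> a b f a0 b0 fCn; have [L HL] := lim_reg a b f a0 b0 fCn.
  split; [|split] => [y0 eps e0|y0|y0 y1].
  - rewrite (integrandE a b).
    have [C dC] :=
      osc_integrand_dominated alpha_ge0 n_gt a0 b0 fCn y0 0 e0 (leq0n n).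
    by apply: dominated_on_cintegrable dC => //; rewrite ltrBrDl.
  - by apply/cvg_ex; exists L; exact: HL.
  - by rewrite /osc_int; do 2!(rewrite (cvg_lim _ (HL _))//).
exists (osc_const n alpha n 0 0); split; [|split; [|split]].
- by move=> a b; exact: osc_const_ge0.
- move=> a b f y0 eps a0 b0 fCn e0 e1.
  have reg_le e : 0 < e -> e <= 1 -> Normc.normc (reg_int a b y0 f e) <=
      osc_const n alpha n 0 0 a b * Cn_alpha_norm b n alpha f.
    move=> ? ?; rewrite regE; apply: osc_term_le => //.
    by rewrite -addnn.
  split; first exact: reg_le.
  have [L HL] := lim_reg a b f a0 b0 fCn.
  rewrite /osc_int (cvg_lim _ (HL y0))//.
  have /cvgC_normc := HL y0.
  (* The bound for positive eps passes to the limit up to an arbitrary d. *)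
  move=> HLn; apply/ler_addgt0Pr => d d0.
  near (0 : R)^'+ => e.
  rewrite -(subrK (reg_int a b y0 f e) L) addrC.
  apply: (le_trans (ler_normcD _ _)); apply: lerD.
    apply: reg_le => //; near: e; exact: nbhs_right_le.
  rewrite -normcN opprB.
  have : `|0 - Normc.normc (reg_int a b y0 f e - L)| < d.
    by near: e; move/cvgrPdist_lt : HLn; apply.
  by rewrite sub0r normrN ger0_norm ?normc_ge0// => /ltW.
- apply: continuous_in_subspaceT => p; rewrite inE/= => -[].
  exact: osc_const_continuous.
- move=> b b0; have [C C0 HC] := osc_const_decay n_gt n 0 0 b0.
  exists C, 1 => a a1.
  have a0 : a != 0 by rewrite -normr_gt0 (lt_le_trans ltr01).
  rewrite ger0_norm; first by have := HC a a1; rewrite n0 expr1.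
  exact: osc_const_ge0.
Unshelve. all: by end_near. Qed.
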